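(* Let $n\ge1$, let $r\ge2$ be an integer, for each $1\le j\le n$ let $A_j\subseteq\{0,\dots,r-1\}$ be a nonempty set of integers, $\mathcal{K}_j\subset[0,1]$ the attractor of $\{x\mapsto(x+a)/r:a\in A_j\}$, $\mathcal{K}=\prod_{j=1}^n\mathcal{K}_j$, and $\mu$ the canonical self-similar measure of $\mathcal{K}$. Then for any $n$-tuple $\Psi=(\psi_1,\dots,\psi_n)$ of approximation functions $\psi_i:\mathbb{N}\to[0,\infty)$, $$\mu(\mathbf{Bad}_{\operatorname{Int}}(\mathcal{K};\Psi))=0.$$
   Context: The canonical self-similar measure $\mu$ is the unique Borel probability measure supported on $\mathcal{K}$ with $\mu(A)=\frac{1}{\#\Lambda}\sum_{\mathbf{i}\in\Lambda}\mu(\mathbf{f}_{\mathbf{i}}^{-1}(A))$ for Borel $A$, where $\Lambda=\prod_jA_j$ and $\mathbf{f}_{\mathbf{i}}(\mathbf{x})=((x_1+i_1)/r,\dots,(x_n+i_n)/r)$. $\mathcal{W}_{\operatorname{Int}}(\mathcal{K};\Psi)$ is the set of $\mathbf{x}\in\mathcal{K}$ such that $|x_i-p_i/q|<\psi_i(q)/q$ for all $1\le i\le n$ for infinitely many $\mathbf{p}/q=(p_1/q,\dots,p_n/q)\in\mathbb{Q}^n\cap\mathcal{K}$ ($q\in\mathbb{N}$). For $c>0$, $c\Psi=(c\psi_1,\dots,c\psi_n)$, and $\mathbf{Bad}_{\operatorname{Int}}(\mathcal{K};\Psi)=\mathcal{W}_{\operatorname{Int}}(\mathcal{K};\Psi)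\setminus\bigcap_{\ell\in\mathbb{N}}\mathcal{W}_{\operatorname{Int}}(\mathcal{K};\tfrac1\ell\Psi)$.
   Formalization: The approximation functions are additionally assumed to satisfy ψ_j(q)/q → 0 as q → ∞ for each j; for arbitrary ψ_j the claim fails, e.g. K = (Cantor set)×[0,1] with Ψ(q) = (2q, 2) at powers q of 5 and Ψ(q) = (0, 0) otherwise. *)

(* Defs.v *)
From HB Require Import structures.
From mathcomp Require Import all_boot all_order all_algebra.
From mathcomp Require Import all_classical all_reals all_analysis.

Set Implicit Arguments.
Unset Strict Implicit.
Unset Printing Implicit Defensive.
Import Order.TTheory GRing.Theory Num.Theory.
Import numFieldNormedType.Exports.
Local Open Scope classical_set_scope.
Local Open Scope ring_scope.

(* By Hutchinson's theorem exactly one set satisfies this predicate when [A] is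
   nonempty and [1 < r]; it is then contained in [0, 1]. *)
Definition is_attractor (R : realType) (r : nat) (A : {set 'I_r})
    (K : set R) : Prop :=
  [/\ compact K, K !=set0 &
      K = \bigcup_(a in [set a | a \in A])
            [set (x + (a : nat)%:R) / r%:R | x in K]].

(* Points of R^n are tuples: [n.-tuple R] carries the product sigma-algebra of
   the Borel sigma-algebra of R, which is the Borel sigma-algebra of R^n. *)
Definition prod_set (R : realType) (n : nat) (K : 'I_n -> set R) :
    set (n.-tuple R) :=
  [set x | forall j, K j (tnth x j)].

Definition digit_map (R : realType) (r n : nat) (i : {ffun 'I_n -> 'I_r})
    (x : n.-tuple R) : n.-tuple R :=
  [tuple (tnth x j + (i j : nat)%:R) / r%:R | j < n].

(* [family A] is the set of multi-indices i with [i j \in A j] for all j. *)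
Definition canonical_self_similar_measure (R : realType) (r n : nat)
    (A : 'I_n -> {set 'I_r}) (K : set (n.-tuple R))
    (mu : probability (n.-tuple R) R) : Prop :=
  mu (~` K) = 0%E /\
  forall B : set (n.-tuple R), measurable B ->
    mu B = ((#|family A|%:R : R)^-1%:E *
            \sum_(i in family A) mu (digit_map i @^-1` B))%E.

(* The infinitude refers to the rational points y, i.e. to elements of
   K `&` Q^n; y = p/q need not be in lowest terms. *)
Definition W_Int (R : realType) (n : nat) (K : set (n.-tuple R))
    (Psi : 'I_n -> nat -> R) : set (n.-tuple R) :=
  [set x | K x /\
    infinite_set [set y : n.-tuple R | K y /\
      exists (p : 'I_n -> int) (q : nat),
        [/\ (0 < q)%N,
            forall j, tnth y j = (p j)%:~R / q%:R &
            forall j, `|tnth x j - (p j)%:~R / q%:R| < Psi j q / q%:R]]].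

Definition Bad_Int (R : realType) (n : nat) (K : set (n.-tuple R))
    (Psi : 'I_n -> nat -> R) : set (n.-tuple R) :=
  W_Int K Psi `\`
  \bigcap_(l in [set l : nat | (0 < l)%N])
    W_Int K (fun j q => l%:R^-1 * Psi j q).

(* Main.v *)
(* It suffices to divide one function [Psi j0] by an integer at a time. Fix N and let D be
   the set of the points of the limsup set of Psi that lie in none of the boxes of the new
   tuple of index at least N. Through a point x of D, and for arbitrarily small boxes
   around a rational y, the line parallel to the j0-axis meets a shrunken box, which misses
   D, in a piece of K comparable to the part of K between x and y: there is a hole
   cylinder next to x. Cutting K into the cylinders of a common high level M, which all
   carry the same mass, reduces to counting words, separately in each fibre obtained by
   freezing the digits of the coordinates other than j0. In a fibre, minimal hole words are
   disjoint, so the words next to a hole are at most C times as many as those in a hole.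
   Hence mu D <= C * mu (U \ D) for every neighbourhood U of D of a suitable family that
   decreases to D, and mu D = 0. No product structure of mu is used, only the equal masses. *)
Require Import Defs.
From HB Require Import structures.
From mathcomp Require Import all_boot all_order all_algebra.
From mathcomp Require Import all_classical all_reals all_analysis.
From mathcomp Require Import measurable_realfun ereal_normedtype.
From mathcomp Require Import lra ring zify.
Set Implicit Arguments.
Unset Strict Implicit.
Unset Printing Implicit Defensive.

(** * Counting words in base [r] near a hole *)

Section Words.
Variables (r : nat) (d : pred nat).
Hypothesis r_gt0 : (0 < r)%N.

(* A word of length [m] is coded by its value in base [r], its last digit being
   [k %% r]; its prefix of length [m - s] is then [k %/ r ^ s]. *)
Fixpoint word (m k : nat) : bool :=
  if m is m'.+1 then d (k %% r) && word m' (k %/ r) else k == 0.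

Lemma word_lt m k : word m k -> k < r ^ m.
Proof.
elim: m k => [|m IH] k /=; first by move/eqP->.
by case/andP=> _ /IH; rewrite ltn_divLR // expnSr.
Qed.

Definition nwords (m : nat) (p : pred nat) : nat :=
  \sum_(k < r ^ m | word m k && p k) 1.

Lemma nwords_children m (p : pred nat) :
  nwords m.+1 (fun k => p (k %/ r)) = (\sum_(a < r | d a) 1) * nwords m p.
Proof.
rewrite /nwords (big_mkcond (fun k : 'I_(r ^ m.+1) => _ && _)) expnSr.
rewrite -(big_mkord xpredT (fun k => if word m.+1 k && p (k %/ r) then 1 else 0)).
rewrite (big_nat_mul _ (r ^ m) r) big_mkord mulnC big_distrl /=.
rewrite [RHS]big_mkcond /=; apply: eq_bigr => i _.
rewrite -{1}[(i * r)%N]add0n mulSn big_addn addnK big_mkord.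
rewrite mul1n big_mkcond /=; case: ifP => wp; last first.
  rewrite big1 // => a _; case: ifP => //.
  by rewrite addnC modnMDl divnMDl // divn_small // addn0 -andbA wp andbF.
rewrite [RHS]big_mkcond; apply: eq_bigr => a _ /=.
by rewrite addnC modnMDl modn_small // divnMDl // divn_small // addn0 -andbA wp andbT.
Qed.

Lemma nwords_le m (p q : pred nat) :
  (forall k, word m k -> p k -> q k) -> nwords m p <= nwords m q.
Proof.
move=> pq; rewrite /nwords !sum1_card; apply: subset_leq_card.
by apply/fintype.subsetP => k; rewrite !unfold_in => /andP[wk pk]; rewrite wk pq.
Qed.

Lemma nwordsU m (p q : pred nat) :
  nwords m (fun k => p k || q k) <= nwords m p + nwords m q.
Proof.
rewrite /nwords !(big_mkcond (fun _ => _ && _)) -big_split leq_sum // => k _ /=.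
by case: word; case: p; case: q.
Qed.

Lemma nwordsD m (p q : pred nat) : (forall k, word m k -> q k -> p k) ->
  nwords m p = nwords m q + nwords m (fun k => p k && ~~ q k).
Proof.
move=> qp; rewrite /nwords !(big_mkcond (fun _ => _ && _)) -big_split.
apply: eq_bigr => k _ /=; move: (qp k).
by case: (word m k) (p k) (q k) => [] [] [] // /(_ isT isT).
Qed.

Definition close_by (L u v : nat) : bool := (u <= v + L) && (v <= u + L).

Lemma close_by_div L u v : close_by L u v -> close_by L (u %/ r) (v %/ r).
Proof.
suff H a b : a <= b + L -> a %/ r <= b %/ r + L by case/andP=> ? ?; rewrite /close_by !H.
move=> ab; have := leq_div2r r ab; move/leq_trans; apply.
have -> : b %/ r + L = (b + L * r) %/ r by rewrite divnDMl.
by apply: leq_div2r; rewrite leq_add2l leq_pmulr.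
Qed.

Lemma count_close_by L R v : \sum_(u < R | close_by L u v) 1 <= 2 * L + 1.
Proof.
rewrite sum1_card -[X in _ <= X]card_ord.
rewrite -(card_in_imset (f := fun u : 'I_R => inord (u + L - v) : 'I_(2 * L).+1)).
  by rewrite addn1; apply: max_card.
move=> a b; rewrite !unfold_in /close_by => /andP[? ?] /andP[? ?].
move/(congr1 val); rewrite /= !inordK; [|lia|lia].
by move=> ?; apply/val_inj => /=; lia.
Qed.

(** Double counting of the pairs [(u, v)]: each [v] is close to at most [2 * L + 1] numbers [u]. *)
Lemma nwords_close_by L m (p : pred nat) :
  nwords m (fun u => [exists v : 'I_(r ^ m), [&& word m v, p v & close_by L u v]])
    <= (2 * L + 1) * nwords m p.
Proof.
rewrite /nwords mulnC big_distrl /=.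
apply: (@leq_trans (\sum_(u < r ^ m) \sum_(v < r ^ m | word m v && p v) close_by L u v)).
  rewrite big_mkcond leq_sum // => u _; case: ifP => // /andP[_ /existsP[v]].
  by case/and3P=> wv pv uv; rewrite (bigD1 v) ?wv ?pv //= uv leq_addr.
rewrite exchange_big leq_sum //= => v _; rewrite mul1n.
have -> : \sum_(u < r ^ m) close_by L u v = \sum_(u < r ^ m | close_by L u v) 1.
  by rewrite [RHS]big_mkcond; apply: eq_bigr => u _; case: close_by.
exact: count_close_by.
Qed.

Section Covering.
Variables (L : nat) (P : nat -> pred nat).

Fixpoint has_hole (m k : nat) : bool :=
  P m k || (if m is m'.+1 then has_hole m' (k %/ r) else false).

Definition near_hole m u :=
  [exists v : 'I_(r ^ m), [&& word m v, P m v & close_by L u v]].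

Fixpoint has_near_hole (m k : nat) : bool :=
  near_hole m k || (if m is m'.+1 then has_near_hole m' (k %/ r) else false).

Lemma has_hole_exists m h : has_hole m h ->
  exists2 s, s <= m & P (m - s) (h %/ r ^ s).
Proof.
elim: m h => [|m IH] h /=; first by rewrite orbF => ?; exists 0; rewrite ?divn1.
case/orP=> [?|/IH[s ? ?]]; first by exists 0; rewrite ?divn1.
by exists s.+1; rewrite // expnS divnMA subSS.
Qed.

Lemma has_near_hole_prefix s m u v : word m v -> P m v -> close_by L (u %/ r ^ s) v ->
  has_near_hole (m + s) u.
Proof.
elim: s u => [|s IH] u wv Pv.
  rewrite expn0 divn1 addn0 => uv.
  suff nu : near_hole m u by case: m wv Pv nu => [|m] /= _ _ ->.
  by apply/existsP; exists (Ordinal (word_lt wv)); apply/and3P.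
by rewrite addnS /= expnS divnMA => ?; rewrite IH ?orbT.
Qed.

(** Truncation keeps words [L]-close, so [u] and [v] can both be cut to the length of a hole among
    the prefixes of [v]. *)
Lemma near_has_hole m u v : word m v -> has_hole m v -> close_by L u v ->
  has_near_hole m u.
Proof.
elim: m u v => [|m IH] u v wv /=; rewrite ?orbF.
  by move=> Pv uv; apply/existsP; exists (Ordinal (word_lt wv)); apply/and3P.
case/orP=> [Pv|hv] uv; apply/orP; [left|right].
  by apply/existsP; exists (Ordinal (word_lt wv)); apply/and3P.
by apply: IH hv (close_by_div uv); case/andP: wv.
Qed.

(* Only holes with no hole among their proper prefixes matter: those are disjoint,
   and each one is near at most [2 * L + 1] words of its own length. *)
Lemma covering m :
  nwords m (has_near_hole m) <= (2 * L + 1) * nwords m (has_hole m).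
Proof.
elim: m => [|m IH].
  apply: leq_trans (nwords_close_by L 0 (has_hole 0)); apply: nwords_le => k _ /=.
  rewrite orbF => /existsP[v] /and3P[? ? ?]; apply/existsP; exists v.
  by apply/and3P; rewrite orbF.
(* [ch] marks the words with a hole among their proper prefixes. The induction hypothesis,
   multiplied by the number of digits, accounts for these; the other holes pay for their own
   neighbours. *)
pose ch k := has_hole m (k %/ r).
rewrite (@nwordsD m.+1 (has_hole m.+1) ch); last by move=> k _ hk; apply/orP; right.
rewrite mulnDr nwords_children mulnCA.
apply: leq_trans (leq_add (leq_mul (leqnn _) IH) (nwords_close_by _ _ _)).
rewrite -nwords_children; apply: leq_trans (nwordsU _ _ _).
apply: nwords_le => k _ /= /orP[/existsP[v] /and3P[wv Pv kv]|->//].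
(* If [v] has a hole among its proper prefixes, then a proper prefix of [k] is already near a
   hole. *)
have [hv|nhv] := boolP (has_hole m (v %/ r)); last first.
  apply/orP; right; apply/existsP; exists v; apply/and3P; split=> //.
  by apply/andP; split=> //; apply/orP; left.
by rewrite (near_has_hole _ hv (close_by_div kv)) //; case/andP: wv.
Qed.

End Covering.
End Words.

(** * From fibres to all multi-indices *)

Section Fibres.
Variables (n R : nat) (j0 : 'I_n).
Implicit Types w : {ffun 'I_n -> 'I_R}.

Definition upd w (k : 'I_R) : {ffun 'I_n -> 'I_R} :=
  [ffun j => if j == j0 then k else w j].

(** Every word equals [upd w k] for exactly [R] pairs [(w, k)], since the entry of [w] at [j0] is
    forgotten. *)
Lemma sum_fibres (F : {ffun 'I_n -> 'I_R} -> nat) :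
  \sum_w \sum_k F (upd w k) = R * \sum_w F w.
Proof.
pose f (q : {ffun 'I_n -> 'I_R} * 'I_R) := (upd q.1 q.2, q.1 j0).
have fK : involutive f.
  case=> w k; rewrite /f /= ffunE eqxx; congr (_, _).
  by apply/ffunP => j; rewrite !ffunE; case: eqP => [->|].
rewrite pair_big (reindex_inj (inv_inj fK)) /=.
rewrite (eq_bigr (fun q => F q.1)); last by move=> q _; rewrite -[in RHS](fK q).
rewrite -(pair_big xpredT xpredT (fun w (_ : 'I_R) => F w)) big_distrr /=.
by apply: eq_bigr => w _; rewrite sum_nat_const card_ord.
Qed.

Lemma card_fibres_le C (S H : pred {ffun 'I_n -> 'I_R}) :
  (forall w, #|[pred k | S (upd w k)]| <= C * #|[pred k | H (upd w k)]|) ->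
  #|S| <= C * #|H|.
Proof.
move=> SH; case: (posnP R) => [R0|R_gt0].
  by rewrite eq_card0 // => w; have := ltn_ord (w j0); rewrite [X in _ < X]R0.
rewrite -(leq_pmul2l R_gt0) mulnCA -!sum1_card !(big_mkcond (in_mem^~ _)).
rewrite -!sum_fibres big_distrr /= leq_sum // => w _; rewrite -!big_mkcond !sum1_card.
exact: SH.
Qed.

End Fibres.

Import Order.TTheory GRing.Theory Num.Theory.
Import numFieldNormedType.Exports.
Local Open Scope classical_set_scope.
Local Open Scope ring_scope.

(** * Self-similarity at level [M] *)

Section Levels.
Variables (R : realType) (n r : nat) (A : 'I_n -> {set 'I_r}).
Hypothesis r_ge2 : (2 <= r)%N.

Let r_gt0 : (0 < r)%N := ltnW r_ge2.

Definition digit (D : {set 'I_r}) (a : nat) : bool :=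
  [exists i in D, i == a :> nat].

Definition is_word M (w : {ffun 'I_n -> 'I_(r ^ M)}) : bool :=
  [forall j, word r (digit (A j)) M (w j)].

Definition word_map (M : nat) (w : 'I_n -> nat) (x : n.-tuple R) : n.-tuple R :=
  [tuple (tnth x j + (w j)%:R) / r%:R ^+ M | j < n].

Lemma measurable_word_map M w B : measurable B -> measurable (word_map M w @^-1` B).
Proof.
move=> mB; rewrite -[X in measurable X]setTI.
suff : measurable_fun setT (word_map M w) by apply.
apply/measurable_fun_tnthP => j.
rewrite (_ : _ \o _ = fun x => (tnth x j + (w j)%:R) * (r%:R ^+ M)^-1); last first.
  by apply/funext => x /=; rewrite tnth_mktuple.
by apply: measurable_funM => //; apply: measurable_funD => //; exact: measurable_tnth.
Qed.

Lemma digitP (D : {set 'I_r}) (i : 'I_r) : digit D i = (i \in D).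
Proof.
by apply/existsP/idP => [[k /andP[kD /eqP/val_inj<-]]|iD] //; exists i; rewrite iD /=.
Qed.

Lemma append_subproof M (c : 'I_(r ^ M)) (i : 'I_r) : (c * r + i < r ^ M.+1)%N.
Proof. by rewrite expnSr -ltn_divLR // divnMDl // divn_small // addn0. Qed.

Lemma prefix_subproof M (c : 'I_(r ^ M.+1)) : (c %/ r < r ^ M)%N.
Proof. by rewrite ltn_divLR // -expnSr. Qed.

Lemma last_subproof (k : nat) : (k %% r < r)%N.
Proof. by rewrite ltn_mod. Qed.

Variables (K : set (n.-tuple R)) (mu : probability (n.-tuple R) R).
Hypothesis mu_canonical : canonical_self_similar_measure A K mu.

Let N : R := #|family A|%:R.

(** Self-similarity iterated [M] times: a word of length [M + 1] splits into its prefix and its last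
    digit, whose map is applied first. *)
Lemma level_measure M B : measurable B ->
  mu B = ((N ^- M)%:E * \sum_(w | is_word (M := M) w) mu (word_map M (fun j => w j) @^-1` B))%E.
Proof.
move=> mB; elim: M => [|M IH].
  rewrite expr0 invr1 mul1e.
  pose w0 : {ffun 'I_n -> 'I_(r ^ 0)} := [ffun => ord0].
  rewrite (big_pred1 w0).
    congr (mu _); apply/funext => x /=; congr B; apply/eq_from_tnth => j.
    by rewrite tnth_mktuple ffunE /= addr0 expr0 invr1 mulr1.
  move=> w /=; rewrite (_ : w = w0) ?eqxx; last first.
    by apply/ffunP => j; apply/val_inj; case: (w j) (w0 j) => -[|?] ? [[|?] ?].
  by apply/forallP => j; rewrite ffunE.
rewrite {}IH exprSr invfM EFinM -muleA; congr (_ * _)%E.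
pose h (q : {ffun 'I_n -> 'I_(r ^ M)} * {ffun 'I_n -> 'I_r}) :
  {ffun 'I_n -> 'I_(r ^ M.+1)} := [ffun j => Ordinal (append_subproof (q.1 j) (q.2 j))].
pose h' (w : {ffun 'I_n -> 'I_(r ^ M.+1)}) :
    {ffun 'I_n -> 'I_(r ^ M)} * {ffun 'I_n -> 'I_r} :=
  ([ffun j => Ordinal (prefix_subproof (w j))], [ffun j => Ordinal (last_subproof (w j))]).
have hK w : h (h' w) = w.
  by apply/ffunP => j; apply/val_inj; rewrite !ffunE /= -divn_eq.
have h'K q : h' (h q) = q.
  case: q => c i; congr (_, _); apply/ffunP => j; apply/val_inj; rewrite !ffunE /=.
    by rewrite divnMDl // divn_small // addn0.
  by rewrite modnMDl modn_small.
rewrite [in RHS](reindex_onto h h') /=; last by move=> w _; exact: hK.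
rewrite (eq_bigl (fun q => is_word q.1 && (q.2 \in family A))); last first.
  move=> q; rewrite h'K eqxx andbT /is_word; apply/forallP/andP => [H|[/forallP H /familyP H2] j].
    split; first by apply/forallP => j; have := H j;
      rewrite ffunE /= divnMDl // divn_small // addn0 => /andP[].
    by apply/familyP => j; have := H j;
      rewrite ffunE /= modnMDl modn_small // digitP => /andP[].
  rewrite ffunE /= divnMDl // divn_small // addn0 H andbT modnMDl modn_small // digitP; exact: H2.
transitivity ((N^-1)%:E * \sum_(c | is_word c) \sum_(i in family A)
    mu (word_map M.+1 (fun j => h (c, i) j) @^-1` B))%E; last first.
  by rewrite pair_big_dep; congr (_ * _)%E; apply: eq_bigr => -[].
rewrite ge0_sume_distrr; last first.
  by move=> w _; apply: sume_ge0 => i _; exact: measure_ge0.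
apply: eq_bigr => c _; rewrite (mu_canonical.2 _ (measurable_word_map _ _ mB)).
rewrite -/N; congr (_ * _)%E; apply: eq_bigr => i _; congr (mu _).
apply/funext => x /=; congr B; apply/eq_from_tnth => j.
rewrite !tnth_mktuple ffunE /= natrD natrM.
have r0 : r%:R != 0 :> R by rewrite pnatr_eq0 -lt0n.
by rewrite exprSr; field; rewrite r0 expf_neq0.
Qed.

Hypothesis mK : measurable K.

Lemma level_measure_le M (T : set (n.-tuple R)) (S : pred {ffun 'I_n -> 'I_(r ^ M)}) :
  measurable T ->
  (forall w x, is_word w -> K x -> T (word_map M (fun j => w j) x) -> S w) ->
  (mu T <= (N ^- M * #|S|%:R)%:E)%E.
Proof.
move=> mT TS; rewrite (level_measure M mT) EFinM lee_wpmul2l ?lee_fin ?invr_ge0 ?exprn_ge0 //.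
rewrite -sum1_card natr_sum -sumEFin big_mkcond [leRHS]big_mkcond /=.
apply: lee_sum => w _; rewrite unfold_in; have mw := measurable_word_map M (fun j => w j) mT.
have [Sw|nSw] := boolP (S w); case: ifP => // ww; first exact: probability_le1.
rewrite -mu_canonical.1 le_measure ?inE //; first exact: measurableC.
by move=> x /= Tx Kx; rewrite (TS w x) in nSw.
Qed.

Lemma level_measure_ge M (B : set (n.-tuple R)) (H : pred {ffun 'I_n -> 'I_(r ^ M)}) :
  measurable B ->
  (forall w, H w -> is_word w) ->
  (forall w x, H w -> K x -> B (word_map M (fun j => w j) x)) ->
  ((N ^- M * #|H|%:R)%:E <= mu B)%E.
Proof.
move=> mB Hw HB; rewrite (level_measure M mB) EFinM lee_wpmul2l ?lee_fin ?invr_ge0 ?exprn_ge0 //.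
rewrite -sum1_card natr_sum -sumEFin big_mkcond [leRHS]big_mkcond /=.
apply: lee_sum => w _; rewrite unfold_in; have mw := measurable_word_map M (fun j => w j) mB.
have [wH|_] := boolP (H w); last by case: ifP => // _; exact: measure_ge0.
rewrite Hw //; have <- : mu K = 1%E.
  by rewrite -[K]setCK probability_setC ?mu_canonical.1 ?sube0 //; exact: measurableC.
by rewrite le_measure ?inE // => x /= Kx; exact: HB.
Qed.

End Levels.

(** * Digit expansions in a one-dimensional attractor *)

Section Attractor.
Variables (R : realType) (r : nat) (D : {set 'I_r}) (K : set R).
Hypothesis r_ge2 : (2 <= r)%N.
Hypothesis KD : is_attractor D K.

Let r_gt0 : 0 < r%:R :> R. Proof. by rewrite ltr0n ltnW. Qed.

(** Self-similarity gives [s <= (s + r - 1) / r] for the supremum [s] of [K] and [t <= t / r] for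
    the supremum [t] of [- K]; hence [s <= 1] and [t <= 0]. *)
Lemma attractor_in01 x : K x -> 0 <= x <= 1.
Proof.
have [cK K0 KE] := KD.
have [B [_ /(_ (B + 1)) BK]] := compact_bounded cK.
have {}BK y : K y -> `|y| <= B + 1 by move=> Ky; apply: BK => //; rewrite ltrDl.
have hK : has_ubound K by exists (B + 1) => y /BK; apply: le_trans; exact: ler_norm.
have hN : has_ubound (-%R @` K).
  by exists (B + 1) => _ [y /BK By <-]; rewrite (le_trans (ler_norm _)) // normrN.
have r2 : 2 <= r%:R :> R by rewrite ler_nat.
have s1 : sup K <= (sup K + (r%:R - 1)) / r%:R.
  apply: ge_sup => // y; rewrite {1}KE => -[a Da [z Kz <-]].
  rewrite ler_pM2r ?invr_gt0 //; apply: lerD; first by apply: (ub_le_sup hK).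
  by rewrite lerBrDr natr1 ler_nat.
have s2 : sup (-%R @` K) <= sup (-%R @` K) / r%:R.
  apply: ge_sup; first by case: K0 => y Ky; exists (- y), y.
  move=> _ [y + <-]; rewrite {1}KE => -[a Da [z Kz <-]].
  rewrite -mulNr ler_pM2r ?invr_gt0 // opprD.
  apply: (@le_trans _ _ (- z)); first by rewrite gerDl oppr_le0.
  by apply: (ub_le_sup hN); exists z.
move: s1 s2; rewrite !ler_pdivlMr // => s1 s2 Kx.
have r1 : 0 < r%:R - 1 :> R by lra.
have K1 : sup K <= 1 by rewrite -(ler_pM2r r1); lra.
have KN : sup (-%R @` K) <= 0 by rewrite -(ler_pM2r r1); lra.
rewrite (le_trans (ub_le_sup hK Kx)) // andbT -oppr_le0 (le_trans _ KN) //.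
by apply: (ub_le_sup hN); exists x.
Qed.

Lemma attractor_measurable : measurable K.
Proof. by have [cK _ _] := KD; exact: compact_measurable. Qed.

(** [x * r ^ M - k] is the image of [x] under the inverse of the map of the word [k], so [k] codes
    the first [M] digits of an expansion of [x]. *)
Lemma attractor_word M x : K x ->
  exists2 k, word r (digit D) M k & K (x * r%:R ^+ M - k%:R).
Proof.
move=> Kx; elim: M => [|M [k wk]].
  by exists 0%N => //; rewrite expr0 mulr1 subr0.
have [_ _ {1}->] := KD; case=> a Da [y Ky yE].
exists (k * r + a)%N.
  rewrite /= modnMDl modn_small // divnMDl ?(ltnW r_ge2) // divn_small // addn0 wk.
  by rewrite andbT digitP.
suff -> : x * r%:R ^+ M.+1 - (k * r + a)%N%:R = y by [].
have /(congr1 (fun z => z * r%:R)) := yE; rewrite mulfVK ?lt0r_neq0 //.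
by move=> E; rewrite -[RHS](addrK a%:R) E natrD natrM exprSr; ring.
Qed.

Lemma attractor_prefix s m k x : word r (digit D) (m + s) k ->
  K (x * r%:R ^+ (m + s) - k%:R) -> K (x * r%:R ^+ m - (k %/ r ^ s)%:R).
Proof.
elim: s k => [|s IH] k; first by rewrite addn0 expn0 divn1.
rewrite addnS /= expnS divnMA => /andP[/existsP[a /andP[Da /eqP aE]] wk] Kk.
apply: IH => //; have [_ _ ->] := KD; exists a => //.
exists (x * r%:R ^+ (m + s).+1 - k%:R) => //.
rewrite {1}(divn_eq k r) natrD natrM -aE exprSr; field.
by rewrite lt0r_neq0.
Qed.

Lemma attractor_cylinder M k x : word r (digit D) M k ->
  K (x * r%:R ^+ M - k%:R) -> K x.
Proof.
move=> wk /(@attractor_prefix M 0%N k); rewrite expr0 mulr1 divn_small ?subr0; first exact.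
by apply: word_lt wk; rewrite ltnW.
Qed.

End Attractor.

(** * Boxes and measurability of open sets *)

Section Boxes.
Variables (R : realType) (n : nat).

Definition box (x : n.-tuple R) (e : R) : set (n.-tuple R) :=
  [set z | forall j, `|tnth z j - tnth x j| < e].

Definition ratr_tuple (t : n.-tuple rat) : n.-tuple R :=
  [tuple ratr (tnth t j) | j < n].

Lemma ratr_tuple_inj : injective ratr_tuple.
Proof.
move=> s t st; apply/eq_from_tnth => j.
have := congr1 (fun u => tnth u j) st; rewrite !tnth_mktuple; exact: fmorph_inj.
Qed.

Lemma exists_min (f : 'I_n -> R) : (forall j, 0 < f j) ->
  exists2 e, 0 < e & forall j, e <= f j.
Proof.
move=> f0; exists (\big[Order.min/1]_j f j); last by move=> j; exact: bigmin_le.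
by apply: lt_bigmin.
Qed.

Lemma measurable_box x e : measurable (box x e).
Proof.
rewrite (_ : box x e = \bigcap_(j in [set: 'I_n]) ((tnth (T:=R))^~ j @^-1` ball (tnth x j) e)).
  apply: fin_bigcap_measurable => // j _; rewrite -[X in measurable X]setTI.
  apply: measurable_tnth => //; exact: measurable_ball.
by apply/seteqP; split=> z H j => [_|]; [|have := H j I]; rewrite /= /ball /= distrC.
Qed.

(** Such a set is a countable union of boxes with rational centres and radii [1 / (m + 1)]. *)
Lemma box_open_measurable (B : set (n.-tuple R)) :
  (forall x, B x -> exists2 e, 0 < e & box x e `<=` B) -> measurable B.
Proof.
move=> Bo; pose F (q : n.-tuple rat * nat) :=
  if `[< box (ratr_tuple q.1) q.2.+1%:R^-1 `<=` B >]
  then box (ratr_tuple q.1) q.2.+1%:R^-1 else set0.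
rewrite (_ : B = \bigcup_q F q).
  apply: countable_bigcupT_measurable => // q; rewrite /F; case: ifP => // _.
  exact: measurable_box.
apply/seteqP; split=> [x /Bo[e e0 xB]|x [q _]]; last first.
  by rewrite /F; case: ifPn => // /asboolP; exact.
(* With a radius [d < e / 2], the box around a rational point at distance less than [d] from [x]
   stays within [2 * d < e] of [x]. *)
have [m] := ltr_add_invr (divr_gt0 e0 (ltr0n R 2)); rewrite add0r => me.
have [d dE] : exists d, d = m.+1%:R^-1 :> R by eexists.
have d0 : 0 < d by rewrite dE invr_gt0.
rewrite -dE in me.
have /choice[t tx] j : exists q, `|tnth x j - ratr q| < d.
  have /rat_in_itvoo[q] : tnth x j - d < tnth x j + d by lra.
  by rewrite in_itv /= => ?; exists q; rewrite ltr_distlC.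
exists ([tuple t j | j < n], m) => //; rewrite /F /= -dE.
have xt j : `|tnth x j - tnth (ratr_tuple [tuple t j | j < n]) j| < d.
  by rewrite !tnth_mktuple.
case: ifPn => [_|/asboolP[]] // z zt; apply: xB => j.
have := zt j; have := xt j; rewrite !ltr_distl => /andP[? ?] /andP[? ?]; lra.
Qed.

End Boxes.

(** * [W_Int] as a limsup of open sets *)

Section LimsupOfBoxes.
Variables (R : realType) (n : nat) (K : set (n.-tuple R)).
Implicit Types (Psi : 'I_n -> nat -> R) (t : n.-tuple rat).

(** The point [t] and the denominator [q] are kept apart: a rational point has many denominators,
    while [W_Int] counts points. *)
Definition approx_by Psi t (q : nat) : set (n.-tuple R) :=
  [set x | [/\ (0 < q)%N,
    exists p : 'I_n -> int, forall j, ratr (tnth t j) = (p j)%:~R / q%:R :> R &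
    forall j, `|tnth x j - ratr (tnth t j)| < Psi j q / q%:R]].

(* [pickle] numbers the rational points, so that [W_Int] is a limsup of open sets. *)
Definition approx_from Psi (k : nat) : set (n.-tuple R) :=
  [set x | exists t q, [/\ (k <= pickle t)%N, K (ratr_tuple R t) & approx_by Psi t q x]].

Lemma approx_open Psi t q x : approx_by Psi t q x ->
  exists2 e, 0 < e & box x e `<=` approx_by Psi t q.
Proof.
move=> [q0 tp xt].
have [|e e0 ef] := @exists_min R n (fun j => Psi j q / q%:R - `|tnth x j - ratr (tnth t j)|).
  by move=> j; rewrite subr_gt0.
exists e => // z zx; split=> // j; have := zx j; have := ef j.
have := ler_distD (tnth x j) (tnth z j) (ratr (tnth t j)); lra.
Qed.

Lemma approx_from_open Psi k x : approx_from Psi k x ->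
  exists2 e, 0 < e & box x e `<=` approx_from Psi k.
Proof.
move=> [t [q [kt Kt /approx_open[e e0 xe]]]]; exists e => // z /xe ?.
by exists t, q.
Qed.

Lemma approx_from_le Psi k l : (k <= l)%N -> approx_from Psi l `<=` approx_from Psi k.
Proof. by move=> kl x [t [q [lt Kt xt]]]; exists t, q; split=> //; exact: leq_trans lt. Qed.

Lemma approxE Psi x y : K y /\
      (exists (p : 'I_n -> int) (q : nat),
        [/\ (0 < q)%N,
            forall j, tnth y j = (p j)%:~R / q%:R &
            forall j, `|tnth x j - (p j)%:~R / q%:R| < Psi j q / q%:R]) <->
  exists t q, [/\ y = ratr_tuple R t, K (ratr_tuple R t) & approx_by Psi t q x].
Proof.
split=> [[Ky [p [q [q0 yp xp]]]]|[t [q [-> Kt [q0 [p tp] xt]]]]].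
  pose t : n.-tuple rat := [tuple (p j)%:~R / q%:R | j < n].
  have tE j : ratr (tnth t j) = (p j)%:~R / q%:R :> R.
    by rewrite tnth_mktuple rmorphM fmorphV /= ratr_int ratr_nat.
  have yt : y = ratr_tuple R t.
    by apply/eq_from_tnth => j; rewrite tnth_mktuple tE yp.
  exists t, q; split=> //; first by rewrite -yt.
  by split=> // [|j]; [exists p|rewrite tE].
split=> //; exists p, q; split=> // j; first by rewrite tnth_mktuple.
by rewrite -tp.
Qed.

Lemma W_IntE Psi : W_Int K Psi = K `&` \bigcap_k approx_from Psi k.
Proof.
apply/seteqP; split=> x [Kx]; last first.
  move=> xO; split=> // fin.
  set Y := (X in finite_set X) in fin.
  have : finite_set (pickle @` (@ratr_tuple R n @^-1` Y)).
    by apply/finite_image/finite_preimage => // s t _ _; exact: ratr_tuple_inj.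
  move=> /finite_seqP[s sE].
  have [t [q [+ Kt xt]]] := xO (\max_(i <- s) i).+1 I.
  apply/negP; rewrite -leqNgt; apply: leq_bigmax_seq => //.
  have : (pickle @` (@ratr_tuple R n @^-1` Y)) (pickle t).
    by exists t => //; apply/approxE; exists t, q.
  by rewrite sE.
move=> inf; split=> // k _; apply: contrapT => nO; apply: inf.
apply: (@sub_finite_set _ _ (@ratr_tuple R n @` (pickle @^-1` `I_k))).
  move=> y /approxE[t [q [-> Kt xt]]]; exists t => //=.
  by rewrite ltnNge; apply/negP => kt; apply: nO; exists t, q.
apply/finite_image/finite_preimage => // s t _ _.
by apply: (pcan_inj (g := unpickle)); exact: pickleK.
Qed.

Hypothesis K01 : forall x j, K x -> 0 <= tnth x j <= 1.

(* Only finitely many points of [K] have a denominator below a given bound. *)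
Lemma approx_small Psi x k (j0 : 'I_n) rho :
  Psi j0 q / q%:R @[q --> \oo] --> (0 : R) -> 0 < rho ->
  (\bigcap_k approx_from Psi k) x ->
  exists t q, [/\ (k <= pickle t)%N, K (ratr_tuple R t), approx_by Psi t q x &
    Psi j0 q / q%:R < rho].
Proof.
move=> /cvgrPdist_lt/(_ rho) + rho0 xO => /(_ rho0)[Q _ Qrho].
pose tup (a : {ffun 'I_n -> 'I_Q} * 'I_Q) : n.-tuple rat :=
  [tuple (a.1 j)%:R / a.2%:R | j < n].
(* A number above those of all [tup] forces [q >= Q]: for [q < Q] the unit cube gives
   [0 <= p j <= q < Q], so [t] would be some [tup]. *)
have [t [q [kt Kt xt]]] := xO (maxn k (\max_a pickle (tup a)).+1) I.
exists t, q; split=> //; first by apply: leq_trans kt; exact: leq_maxl.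
have [Qq|qQ] := leqP Q q.
  by have := Qrho q Qq; rewrite /= sub0r normrN; apply: le_lt_trans; exact: ler_norm.
exfalso; have [q0 [p tp] _] := xt.
have q0R : 0 < q%:R :> R by rewrite ltr0n.
have /choice[c cp] j : exists c : 'I_Q, p j = (c : nat)%:Z.
  have := K01 j Kt; rewrite tnth_mktuple tp ler_pdivlMr // ler_pdivrMr // mul0r mul1r.
  case: (p j) => [m|m]; last by rewrite ler0z.
  rewrite -!pmulrn ler_nat => /andP[_] /leq_ltn_trans/(_ qQ) mQ; by exists (Ordinal mQ).
have tE : t = tup ([ffun j => c j], Ordinal qQ).
  apply/eq_from_tnth => j; apply: (fmorph_inj (@ratr R)).
  by rewrite /= tp cp tnth_mktuple /= ffunE rmorphM fmorphV /= !ratr_nat.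
have := leq_trans (leq_maxr _ _) kt; rewrite ltnNge => /negP; apply.
by rewrite tE; exact: leq_bigmax.
Qed.

End LimsupOfBoxes.

(** * Cylinders of the product set *)

Section Cylinders.
Variables (R : realType) (n r : nat).
Hypothesis r_ge2 : (2 <= r)%N.
Variables (A : 'I_n -> {set 'I_r}) (K : 'I_n -> set R).
Hypothesis K_attractor : forall j, is_attractor (A j) (K j).

Definition cylinder M (w : {ffun 'I_n -> 'I_(r ^ M)}) : set (n.-tuple R) :=
  [set x | forall j, K j (tnth x j * r%:R ^+ M - (w j)%:R)].

Let r_gt0 : 0 < r%:R :> R. Proof. by rewrite ltr0n ltnW. Qed.

Lemma measurable_prod_set : measurable (prod_set K).
Proof.
rewrite (_ : prod_set K = \bigcap_(j in [set: 'I_n]) ((tnth (T:=R))^~ j @^-1` K j)).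
  apply: fin_bigcap_measurable => // j _; rewrite -[X in measurable X]setTI.
  apply: measurable_tnth => //; exact: attractor_measurable (K_attractor j).
by apply/seteqP; split=> z H j => [_|]; [|have := H j I].
Qed.

Lemma cylinder_word_map M (w : {ffun 'I_n -> 'I_(r ^ M)}) x : prod_set K x ->
  cylinder w (word_map r M (fun j => w j) x).
Proof.
move=> Kx j; rewrite tnth_mktuple mulfVK ?addrK; first exact: Kx.
by rewrite expf_neq0 // lt0r_neq0.
Qed.

Lemma measurable_cylinder M (w : {ffun 'I_n -> 'I_(r ^ M)}) : measurable (cylinder w).
Proof.
rewrite (_ : cylinder w = \bigcap_(j in [set: 'I_n])
    ((fun x : n.-tuple R => tnth x j * r%:R ^+ M - (w j)%:R) @^-1` K j)).
  apply: fin_bigcap_measurable => // j _; rewrite -[X in measurable X]setTI.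
  suff : measurable_fun setT (fun x : n.-tuple R => tnth x j * r%:R ^+ M - (w j)%:R).
    by apply=> //; exact: attractor_measurable (K_attractor j).
  apply: measurable_funB => //; apply: measurable_funM => //; exact: measurable_tnth.
by apply/seteqP; split=> z H j => [_|]; [|have := H j I].
Qed.

Lemma cylinder_sub M (w : {ffun 'I_n -> 'I_(r ^ M)}) :
  is_word A w -> cylinder w `<=` prod_set K.
Proof.
by move=> /forallP ww x xw j; exact: attractor_cylinder (ww j) (xw j).
Qed.

Lemma prod_set_in01 x j : prod_set K x -> 0 <= tnth x j <= 1.
Proof. by move=> /(_ j); exact: attractor_in01 (K_attractor j) _. Qed.

Lemma exists_level (e : R) : 0 < e ->
  exists m, forall M, (m <= M)%N -> r%:R ^- M < e.
Proof.
move=> e0; have [m] := ltr_add_invr e0; rewrite add0r => me.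
exists m.+1 => M mM; apply: le_lt_trans me.
rewrite lef_pV2 ?posrE ?exprn_gt0 // -natrX ler_nat.
exact: leq_trans mM (ltnW (ltn_expl _ r_ge2)).
Qed.

Lemma dist_le_level M (y z c : R) : 0 <= y * r%:R ^+ M - c <= 1 ->
  0 <= z * r%:R ^+ M - c <= 1 -> `|y - z| <= r%:R ^- M.
Proof.
move=> yc zc; rewrite -(ler_pM2r (exprn_gt0 M r_gt0)) mulVf ?lt0r_neq0 ?exprn_gt0 //.
rewrite -[X in _ * X]gtr0_norm ?exprn_gt0 // -normrM mulrBl ler_norml; lra.
Qed.

End Cylinders.

(** * Dividing one approximation function by [l] *)

Section OneCoordinate.
Variables (R : realType) (n r : nat).
Hypothesis r_ge2 : (2 <= r)%N.
Variables (A : 'I_n -> {set 'I_r}) (K : 'I_n -> set R).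
Hypothesis K_attractor : forall j, is_attractor (A j) (K j).
Variable mu : probability (n.-tuple R) R.
Hypothesis mu_canonical : canonical_self_similar_measure A (prod_set K) mu.
Variables (j0 : 'I_n) (l : nat) (Psi Psi' : 'I_n -> nat -> R).
Hypothesis l_gt0 : (0 < l)%N.
Hypothesis Psi'_j0 : forall q, Psi' j0 q = l%:R^-1 * Psi j0 q.
Hypothesis Psi'_eq : forall j q, j != j0 -> Psi' j q = Psi j q.
Hypothesis Psi_cvg0 : Psi j0 q / q%:R @[q --> \oo] --> (0 : R).

Let r_gt0 : 0 < r%:R :> R. Proof. by rewrite ltr0n ltnW. Qed.

Section Holes.
Variables (M : nat) (G : set (n.-tuple R)).
Implicit Types w : {ffun 'I_n -> 'I_(r ^ M)}.

(* The fibre consists of the words of length [M] that agree with [w] off [j0];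
   [v] is a prefix, of length [m], of the coordinate [j0]. *)
Definition hole w (m v : nat) : bool := (m <= M)%N &&
  `[< forall h, is_word A h -> (forall j, j != j0 -> h j = w j) ->
        (h j0 %/ r ^ (M - m))%N = v -> cylinder K h `<=` G >].

Definition holed : pred {ffun 'I_n -> 'I_(r ^ M)} := fun w =>
  is_word A w && has_hole r (hole w) M (w j0).

Definition near_holed (L : nat) : pred {ffun 'I_n -> 'I_(r ^ M)} := fun w =>
  is_word A w && has_near_hole r (digit (A j0)) L (hole w) M (w j0).

Lemma hole_upd w k : hole (upd j0 w k) = hole w.
Proof.
apply/funext => m; apply/funext => v; congr (_ && _); apply: asbool_equiv_eq.
by split=> H h hw hE; apply: H => // j jj0; rewrite hE // ffunE (negbTE jj0).
Qed.

Lemma holed_cylinder w : holed w -> cylinder K w `<=` G.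
Proof.
move=> /andP[ww /has_hole_exists[s sM /andP[_ /asboolP]]]; apply=> //.
by rewrite subKn.
Qed.

(** [hole w] does not depend on the entry of [w] at [j0], so [covering] applies in each fibre with
    one fixed hole predicate. *)
Lemma card_near_holed L : (#|near_holed L| <= (2 * L + 1) * #|holed|)%N.
Proof.
apply: (card_fibres_le (j0 := j0)) => w.
pose rest := [forall j, (j != j0) ==> word r (digit (A j)) M (w j)].
have wordE k : is_word A (upd j0 w k) = rest && word r (digit (A j0)) M k.
  apply/forallP/andP => [H|[/forallP H wk] j].
    split; last by have := H j0; rewrite ffunE eqxx.
    apply/forallP => j; apply/implyP => jj0; have := H j; by rewrite ffunE (negbTE jj0).
  by rewrite ffunE; case: eqP (H j) => [->|].
pose p1 k := word r (digit (A j0)) M k && has_near_hole r (digit (A j0)) L (hole w) M k.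
pose p2 k := word r (digit (A j0)) M k && has_hole r (hole w) M k.
have SE : [pred k | near_holed L (upd j0 w k)] =i [pred k : 'I_(r ^ M) | rest && p1 k].
  by move=> k; rewrite inE [RHS]inE /near_holed wordE hole_upd ffunE eqxx -andbA.
have HE : [pred k | holed (upd j0 w k)] =i [pred k : 'I_(r ^ M) | rest && p2 k].
  by move=> k; rewrite inE [RHS]inE /holed wordE hole_upd ffunE eqxx -andbA.
rewrite (eq_card SE) (eq_card HE); case: {wordE SE HE} rest => /=; last by rewrite eq_card0.
have := covering (digit (A j0)) (ltnW r_ge2) L (hole w) M.
by rewrite /nwords !sum1_card.
Qed.

End Holes.

Variable N : nat.

Let D : set (n.-tuple R) := prod_set K `&`
  (\bigcap_k approx_from (prod_set K) Psi k `\` approx_from (prod_set K) Psi' N).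

(** An open neighbourhood of the complement of [B] in the supremum norm. It makes [U k] a
    neighbourhood of [D] in which a point [x] of [D] also captures the holes close to [x]. *)
Definition near_compl (B : set (n.-tuple R)) (e : R) : set (n.-tuple R) :=
  [set z | exists2 x, ~ B x & box z e x].

Let U (k : nat) : set (n.-tuple R) := prod_set K `&`
  (approx_from (prod_set K) Psi k `&`
   near_compl (approx_from (prod_set K) Psi' N) k.+1%:R^-1).

Let L := (l * r + 1)%N.

(** The hole comes from a rational [t] approximating [x]: points of the product set that are close
    to [t] along [j0] and to [x] in the other coordinates satisfy the inequalities of [Psi'] for
    [t], hence lie outside [D]. *)
Lemma eventually_near_holed k x : D x ->
  exists M0, forall M, (M0 <= M)%N -> forall w : {ffun 'I_n -> 'I_(r ^ M)},
    is_word A w -> cylinder K w x -> near_holed (U k `\` D) L w.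
Proof.
move=> [Kx [xO xN]].
have l0 : 0 < l%:R :> R by rewrite ltr0n.
have [kk kkE] : exists kk, kk = k.+1%:R^-1 :> R by eexists.
have k0 : 0 < kk by rewrite kkE invr_gt0.
have k1 : kk <= 1 by rewrite kkE invf_le1 // ler1n.
have K01 := @prod_set_in01 R n r r_ge2 A K K_attractor.
(* The bound [kk / 2] on [rho] puts the hole within [2 * rho < kk] of [x] along [j0], hence inside
   [U k]. *)
have [|t [q [kt Kt xt rho_small]]] :=
    @approx_small R n _ K01 Psi x (maxn k N) j0 (kk / 2) Psi_cvg0 _ xO.
  by rewrite divr_gt0.
set rho := Psi j0 q / q%:R in rho_small.
have xt0 : `|tnth x j0 - ratr (tnth t j0)| < rho by case: xt.
have rho0 : 0 < rho by apply: le_lt_trans xt0.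
have rhol : rho / l%:R <= rho by rewrite ler_pdivrMr // ler_peMr ?ler1n // ltW.
have exm : exists m, r%:R ^- m < rho / l%:R.
  by have [m H] := exists_level r_ge2 (divr_gt0 rho0 l0); exists m; exact: H.
(* The hole gets the least length [m + 1] with [r ^- (m + 1) < rho / l]. Length [0] is excluded by
   [rho / l < 1], and minimality yields [rho <= l * r ^- m]. *)
case: (ex_minnP exm) => -[|m]; first by rewrite expr0 invr1 => ? _; exfalso; lra.
move=> mrho mmin.
have rho_le : rho <= l%:R * r%:R ^- m.
  rewrite -ler_pdivrMl // mulrC leNgt; apply/negP => /mmin; by rewrite ltnn.
have [v wv Kv] := attractor_word r_ge2 (K_attractor j0) m.+1 (Kt j0).
rewrite tnth_mktuple in Kv.
have [e e0 xe] := approx_open xt.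
have [M1 M1e] := exists_level r_ge2 e0.
have [M2 M2k] := exists_level r_ge2 (divr_gt0 k0 (ltr0n R 2)).
exists (maxn m.+1 (maxn M1 M2)) => M; rewrite !geq_max => /and3P[mM M1M M2M] w ww xw.
have rm0 : 0 < r%:R ^+ m.+1 :> R by rewrite exprn_gt0.
have in01 j c : K j c -> 0 <= c <= 1 by exact: attractor_in01 (K_attractor j) _.
have prefix0 (h : {ffun 'I_n -> 'I_(r ^ M)}) z : is_word A h -> cylinder K h z ->
    0 <= tnth z j0 * r%:R ^+ m.+1 - (h j0 %/ r ^ (M - m.+1))%:R <= 1.
  move=> /forallP/(_ j0) hw /(_ j0) zh; apply: (in01 j0).
  by apply: (attractor_prefix r_ge2 (K_attractor j0)); rewrite subnKC.
rewrite /near_holed ww -[X in has_near_hole _ _ _ _ X _](subnKC mM).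
apply: has_near_hole_prefix wv _ _; first exact: ltnW.
  rewrite /hole mM; apply/asboolP => h hw hE hv z zh.
  have Kz : prod_set K z := cylinder_sub r_ge2 K_attractor hw zh.
  have zt0 : `|tnth z j0 - ratr (tnth t j0)| < rho / l%:R.
    apply: le_lt_trans mrho; apply: (dist_le_level r_ge2 (c := v%:R)).
      by rewrite -hv; exact: prefix0.
    exact: (in01 j0).
  have zx j : j != j0 -> `|tnth z j - tnth x j| <= r%:R ^- M.
    move=> jj0; apply: (dist_le_level r_ge2 (c := (w j)%:R)); apply: (in01 j); last exact: xw.
    by rewrite -hE.
  have zt j : j != j0 -> `|tnth z j - ratr (tnth t j)| < Psi j q / q%:R.
    (* [z] may leave the box around [x] along [j0], so its coordinate there is replaced by that of
       [x]. *)
    move=> jj0; have [] := xe [tuple if j == j0 then tnth x j else tnth z j | j < n].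
      move=> i; rewrite tnth_mktuple; case: ifPn => [_|ij0]; first by rewrite subrr normr0.
      by apply: le_lt_trans (zx i ij0) _; exact: M1e.
    by move=> _ _ /(_ j); rewrite tnth_mktuple (negbTE jj0).
  have [q0 tp _] := xt.
  have zPsi' : approx_by Psi' t q z.
    split=> // j; have [->|jj0] := eqVneq j j0; last by rewrite Psi'_eq // zt.
    by rewrite Psi'_j0 -mulrA mulrC -/rho.
  have zPsi : approx_by Psi t q z.
    split=> // j; have [->|jj0] := eqVneq j j0; last exact: zt.
    exact: lt_le_trans zt0 rhol.
  move: kt; rewrite geq_max => /andP[kt Nt].
  split; last by move=> [_ [_ ]]; apply; exists t, q.
  split=> //; split; first by exists t, q.
  rewrite /= -kkE; exists x => // j; have [->|jj0] := eqVneq j j0.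
    move: xt0 zt0; rewrite !ltr_norml; lra.
  by rewrite distrC (le_lt_trans (zx j jj0)) // (lt_trans (M2k M M2M)) //; lra.
have := prefix0 w x ww xw; have := in01 j0 _ Kv.
set u := (w j0 %/ _)%N => yv xu.
have xyr : `|tnth x j0 * r%:R ^+ m.+1 - ratr (tnth t j0) * r%:R ^+ m.+1| < (l * r)%:R.
  rewrite -mulrBl normrM (gtr0_norm rm0) -ltr_pdivlMr //.
  apply: lt_le_trans xt0 _; apply: le_trans rho_le _.
  by rewrite natrM exprS invfM mulrA mulfK ?lt0r_neq0.
(* The scaled coordinates of [x] and [t] differ by less than [l * r]; passing to the integers [u]
   and [v] costs at most [1], whence [L = l * r + 1]. *)
rewrite /close_by /L -!(ler_nat R) !natrD; move: xyr; rewrite ltr_norml; lra.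
Qed.

Let C := (2 * L + 1)%N.

Lemma measurable_D : measurable D.
Proof.
have mO P k : measurable (approx_from (prod_set K) P k).
  by apply: box_open_measurable => x; exact: approx_from_open.
apply: measurableI; first exact: measurable_prod_set K_attractor.
by apply: measurableD => //; exact: bigcap_measurableType.
Qed.

Lemma measurable_U k : measurable (U k).
Proof.
apply: measurableI; first exact: measurable_prod_set K_attractor.
apply: measurableI; apply: box_open_measurable => x.
  exact: approx_from_open.
move=> [y nOy xy].
have [|e e0 ef] := @exists_min R n (fun j => k.+1%:R^-1 - `|tnth y j - tnth x j|).
  by move=> j; rewrite subr_gt0.
exists e => // z zx; exists y => // j; have := zx j; have := ef j.
have := ler_distD (tnth x j) (tnth y j) (tnth z j).
rewrite (distrC (tnth z j)); move: (_^-1) => c; lra.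
Qed.

(** Each point of [D] lies in [T M] for all large [M], and every [T M] obeys the bound; continuity
    from below along the sets [F M0] transfers it to [D]. *)
Lemma mu_D_le k : (mu D <= C%:R%:E * mu (U k `\` D))%E.
Proof.
have mG : measurable (U k `\` D).
  by apply: measurableD; [exact: measurable_U|exact: measurable_D].
have mK := measurable_prod_set K_attractor.
(* A point may lie in several cylinders of level [M]; [T M] asks that all of them be near a hole. *)
pose T M := \bigcap_(w in [set w : {ffun 'I_n -> 'I_(r ^ M)} |
    is_word A w /\ ~~ near_holed (U k `\` D) L w]) ~` cylinder K w.
have mT M : measurable (T M).
  apply: fin_bigcap_measurable => // w _; apply: measurableC.
  by apply: measurable_cylinder.
have T_le M : (mu (T M) <= C%:R%:E * mu (U k `\` D))%E.
  have H : (mu (T M) <= (#|family A|%:R ^- M * #|near_holed (M := M) (U k `\` D) L|%:R)%:E)%E.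
    apply: (level_measure_le r_ge2 mu_canonical mK (mT M)) => w x ww Kx Tx.
    by apply/negPn/negP => nw; apply: (Tx w) => //; exact: cylinder_word_map.
  apply: (le_trans H).
  have {}H : ((#|family A|%:R ^- M * #|holed (M := M) (U k `\` D)|%:R)%:E <= mu (U k `\` D))%E.
    apply: (level_measure_ge r_ge2 mu_canonical mK mG) => [w /andP[]//|w x hw Kx].
    by apply: (holed_cylinder hw); exact: cylinder_word_map.
  apply: le_trans (lee_wpmul2l _ H); last by rewrite lee_fin.
  rewrite -EFinM lee_fin mulrCA ler_wpM2l ?invr_ge0 ?exprn_ge0 // -natrM ler_nat.
  exact: card_near_holed.
pose F M0 := \bigcap_(M in [set M | (M0 <= M)%N]) T M.
have mF M0 : measurable (F M0) by apply: bigcap_measurableType.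
have mUF : measurable (\bigcup_M0 F M0) by exact: bigcup_measurable.
apply: (@le_trans _ _ (mu (\bigcup_M0 F M0))).
  rewrite le_measure ?inE //; first exact: measurable_D.
  move=> x Dx; have [M0 H] := eventually_near_holed k Dx.
  exists M0 => // M M0M w [ww nw] xw; move/negP: nw; apply; exact: H.
have F_homo : {homo F : a b / (a <= b)%N >-> (a <= b)%O}.
  by move=> a b ab; apply/subsetPset => x Fx M bM; apply: Fx; exact: leq_trans bM.
have Fcvg := nondecreasing_cvg_mu (mu := mu) mF mUF F_homo.
rewrite -(cvg_lim _ Fcvg) //.
apply: lime_le; first by apply/cvg_ex; exists (mu (\bigcup_M0 F M0)).
apply: nearW => M; apply: le_trans (T_le M) => /=.
by rewrite le_measure ?inE // => x; apply => /=.
Qed.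

Lemma mu_D_eq0 : mu D = 0%E.
Proof.
have cvgU : mu (U k `\` D) @[k --> \oo] --> 0%E.
  rewrite -(measure0 mu) (_ : set0 = \bigcap_k (U k `\` D)).
    apply: nonincreasing_cvg_mu.
    - rewrite (le_lt_trans (probability_le1 _ _)) ?ltry //.
      by apply: measurableD; [exact: measurable_U|exact: measurable_D].
    - by move=> k; apply: measurableD; [exact: measurable_U|exact: measurable_D].
    - apply: bigcap_measurableType => k _.
      by apply: measurableD; [exact: measurable_U|exact: measurable_D].
    move=> a b ab; apply/subsetPset => x [[Kx [Ox [y nOy xy]]] nDx]; split=> //; split=> //.
    split; first exact: approx_from_le Ox.
    exists y => // j; apply: lt_le_trans (xy j) _.
    by rewrite lef_pV2 ?posrE // ler_nat.
  (* [approx_from] is open, so a point arbitrarily close to its complement belongs to the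
     complement. *)
  apply/esym/seteqP; split=> // x xU; have [[Kx _] nDx] := xU 0%N I.
  apply: nDx; split=> //; split=> [k _|/approx_from_open[e e0 xe]].
    by have [[_ []]] := xU k I.
  have [k] := ltr_add_invr e0; rewrite add0r => ke.
  have [[_ [_ [y nOy xy]]] _] := xU k I.
  by apply: nOy; apply: xe => j; apply: lt_trans ke.
apply/eqP; rewrite -measure_le0.
have cvgC : (C%:R%:E * mu (U k `\` D))%E @[k --> \oo] --> 0%E.
  by rewrite -(mule0 C%:R%:E); exact: cvgeZl.
rewrite -(cvg_lim _ cvgC) //; apply: lime_ge; first by apply/cvg_ex; exists 0%E.
by apply: nearW => k; exact: mu_D_le.
Qed.

End OneCoordinate.

(** * From one coordinate to all of them *)

Section Main.
Variables (R : realType) (n r : nat).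
Hypothesis r_ge2 : (2 <= r)%N.
Variables (A : 'I_n -> {set 'I_r}) (K : 'I_n -> set R).
Hypothesis K_attractor : forall j, is_attractor (A j) (K j).
Variable mu : probability (n.-tuple R) R.
Hypothesis mu_canonical : canonical_self_similar_measure A (prod_set K) mu.

Lemma measurable_W_Int Psi : measurable (W_Int (prod_set K) Psi).
Proof.
rewrite W_IntE; apply: measurableI; first exact: measurable_prod_set K_attractor.
apply: bigcap_measurableType => k _; apply: box_open_measurable => x.
exact: approx_from_open.
Qed.

(** A point outside the smaller limsup set misses [approx_from] of [Psi'] at some index [N], so
    countably many null sets cover the difference. *)
Lemma negligible_one_coordinate (j0 : 'I_n) (l : nat) (Psi Psi' : 'I_n -> nat -> R) :
  (0 < l)%N -> (forall q, Psi' j0 q = l%:R^-1 * Psi j0 q) ->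
  (forall j q, j != j0 -> Psi' j q = Psi j q) ->
  Psi j0 q / q%:R @[q --> \oo] --> (0 : R) ->
  mu.-negligible (W_Int (prod_set K) Psi `\` W_Int (prod_set K) Psi').
Proof.
move=> l0 Pl Pe cvg0; rewrite !W_IntE.
apply: negligibleS (negligible_bigcup (F := fun N => prod_set K `&`
  (\bigcap_k approx_from (prod_set K) Psi k `\` approx_from (prod_set K) Psi' N)) _).
  move=> x [[Kx xO] nO]; have [N NO] : exists N, ~ approx_from (prod_set K) Psi' N x.
    by apply/existsNP => O'; apply: nO; split=> // k _; exact: O'.
  by exists N.
move=> N; apply/negligibleP; first exact: measurable_D K_attractor _ _ _.
exact: (mu_D_eq0 r_ge2 K_attractor mu_canonical l0 Pl Pe cvg0).
Qed.

Lemma negligible_scaled (l : nat) (Psi : 'I_n -> nat -> R) : (0 < l)%N ->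
  (forall j, Psi j q / q%:R @[q --> \oo] --> (0 : R)) ->
  mu.-negligible (W_Int (prod_set K) Psi `\`
                  W_Int (prod_set K) (fun j q => l%:R^-1 * Psi j q)).
Proof.
move=> l0 cvg0.
(* The functions are divided by [l] one after another: [P m] and [P m.+1] differ in coordinate [m]
   only. *)
pose P (m : nat) (j : 'I_n) q := if (j < m)%N then l%:R^-1 * Psi j q else Psi j q.
have -> : (fun j q => l%:R^-1 * Psi j q) = P n.
  by apply/funext => j; apply/funext => q; rewrite /P ltn_ord.
suff H m : (m <= n)%N -> mu.-negligible (W_Int (prod_set K) Psi `\` W_Int (prod_set K) (P m)).
  exact: H.
elim: m => [|m IH] mn.
  by rewrite (_ : P 0 = Psi) ?setDv //; exact: negligible_set0.
apply: negligibleS (negligibleU (IH (ltnW mn))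
   (@negligible_one_coordinate (Ordinal mn) l (P m) (P m.+1) l0 _ _ _)).
- move=> x [Wx nW]; have [Wm|nWm] := pselect (W_Int (prod_set K) (P m) x).
    by right.
  by left.
- by move=> q; rewrite /P /= ltnSn ltnn.
- by move=> j q jm; rewrite /P ltnS leq_eqVlt -[_ == m]/(j == Ordinal mn) (negbTE jm).
- rewrite (_ : P m (Ordinal mn) = Psi (Ordinal mn)); first exact: cvg0.
  by apply/funext => q; rewrite /P /= ltnn.
Qed.

End Main.

(* [Psi_cvg0] is the decay that makes the [Psi j] approximation functions, in
   its weakest form (it follows from [Psi j q --> 0] or from boundedness).
   Without it the conclusion fails: for n = 2, r = 3, digits {0,2} and {0,1,2},
   take Psi = (2q, 2) at powers q of 5 and (0, 0) elsewhere; the only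
   p/5^k in the Cantor set are 0 and 1, so Bad_Int has full measure. *)
Theorem theorem7p1 (R : realType) (n r : nat) (n_ge1 : (1 <= n)%N)
    (r_ge2 : (2 <= r)%N)
    (A : 'I_n -> {set 'I_r}) (A_neq0 : forall j, A j != finset.set0)
    (K : 'I_n -> set R) (K_attractor : forall j, is_attractor (A j) (K j))
    (mu : probability (n.-tuple R) R)
    (mu_canonical : canonical_self_similar_measure A (prod_set K) mu)
    (Psi : 'I_n -> nat -> R)
    (Psi_ge0 : forall j q, 0 <= Psi j q)
    (Psi_cvg0 : forall j, Psi j q / q%:R @[q --> \oo] --> (0 : R)) :
  mu (Bad_Int (prod_set K) Psi) = 0%E.
Proof.
apply: measure_negligible.
  apply: measurableD; first exact: measurable_W_Int K_attractor _.
  by apply: bigcap_measurableType => l _; exact: measurable_W_Int K_attractor _.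
apply: negligibleS (negligible_bigcup (F := fun l => W_Int (prod_set K) Psi `\`
   W_Int (prod_set K) (fun j q => l.+1%:R^-1 * Psi j q)) _).
  move=> x [Wx nI]; apply: contrapT => nl; apply: nI => -[//|l] _.
  by apply: contrapT => nWl; apply: nl; exists l.
by move=> l; exact: (negligible_scaled r_ge2 K_attractor mu_canonical).
Qed.
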